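(* Let $G$ be a strongly co-Hopfian abelian group with torsion subgroup $T$. Then $G$ is uniformly strongly co-Hopfian if and only if $T$ is strongly co-Hopfian.
   Context: All groups are abelian. A group $G$ is strongly co-Hopfian if for every endomorphism $f$ of $G$ there is $n\in\mathbb N$ with $f^n(G)=f^{n+1}(G)$. It is uniformly strongly co-Hopfian if there is a fixed $m\in\mathbb N$ such that $\phi^m(G)=\phi^{m+1}(G)$ for every endomorphism $\phi$ of $G$. *)

(* Defs.v *)
From mathcomp Require Import all_boot all_algebra.
Set Implicit Arguments. Unset Strict Implicit. Unset Printing Implicit Defensive.
Import GRing.Theory.
Local Open Scope ring_scope.

(* Abelian groups are modelled as MathComp zmodTypes (additive notation).
   A subgroup is given by a predicate S : G -> Prop. *)

Definition img (G : zmodType) (f : G -> G) (S : G -> Prop) : G -> Prop :=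
  fun x => exists2 y, S y & x = f y.

(* f restricts to an endomorphism of the subgroup S: it maps S into S
   and is additive on S.  (Endomorphisms of the group S correspond exactly
   to such maps, modulo their irrelevant values outside S.) *)
Definition endo_on (G : zmodType) (S : G -> Prop) (f : G -> G) : Prop :=
  (forall x, S x -> S (f x)) /\
  (forall x y, S x -> S y -> f (x + y) = f x + f y).

Definition same_set (G : zmodType) (A B : G -> Prop) : Prop :=
  forall x, A x <-> B x.

Definition strongly_coHopfian_on (G : zmodType) (S : G -> Prop) : Prop :=
  forall f : G -> G, endo_on S f ->
    exists n : nat, same_set (img (iter n f) S) (img (iter n.+1 f) S).

Definition uniformly_strongly_coHopfian_on (G : zmodType) (S : G -> Prop) : Prop :=
  exists m : nat, forall f : G -> G, endo_on S f ->
    same_set (img (iter m f) S) (img (iter m.+1 f) S).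

Definition whole (G : zmodType) : G -> Prop := fun _ => True.

Definition strongly_coHopfian (G : zmodType) : Prop :=
  strongly_coHopfian_on (@whole G).

Definition uniformly_strongly_coHopfian (G : zmodType) : Prop :=
  uniformly_strongly_coHopfian_on (@whole G).

Definition torsion (G : zmodType) : G -> Prop :=
  fun x => exists2 n : nat, (0 < n)%N & x *+ n = 0.

(* Main.v *)
Require Import Defs.
From HB Require Import structures.
From mathcomp Require Import all_boot all_algebra.
From mathcomp Require Import boolp classical_sets zify.
Set Implicit Arguments. Unset Strict Implicit. Unset Printing Implicit Defensive.
Import GRing.Theory.
Local Open Scope ring_scope.

(* Let G be strongly co-Hopfian. Multiplication by n stabilises, so n^k G lies in
   n^omega G for some k and G = G[n^k] + n^omega G; it follows that the n-primary
   component T_n is a direct summand. An infinite independent sequence in a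
   divisible subgroup, or one of order p^(k+1) whose span meets p^(k+1) G trivially,
   would have a right shift extending to an endomorphism of G, and this endomorphism
   would never stabilise. Hence every G[p^k] is finite, the intersection D of the
   subgroups p^omega G has finite torsion-free rank, and the endomorphisms of G
   stabilise on T_p after a number of steps bounded in terms of p.

   An endomorphism f of T, preceded by the projection of G onto T_n, becomes an
   endomorphism of G that agrees with f on T_n; so a uniform bound for G is one for
   T, each element x of T being in T_n for n the order of x. Conversely, gluing for
   each p an endomorphism of T_p of maximal index shows that, when T is strongly
   co-Hopfian, one N bounds the index on all T_p, hence on T. An endomorphism f of G
   then stabilises on T after N steps, on D modulo T after rank(D) steps, and on G/D
   after N steps: f^n x = f^(n+1) z puts x - f z in Ker f^n, and on the finite groups
   G/p^omega G the kernels of the powers of f are stationary as soon as the images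
   are. *)

Lemma prime_mul_ind (P : nat -> Prop) :
  P 1%N -> (forall p n, prime p -> (0 < n)%N -> P n -> P (p * n)%N) ->
  forall n, (0 < n)%N -> P n.
Proof.
move=> P1 PM; elim/ltn_ind => n IH n_gt0.
have [n_le1|n_gt1] := leqP n 1; first by have -> : n = 1%N by lia.
have p_prime := pdiv_prime n_gt1; have p_dvd := pdiv_dvd n.
have q_gt0 : (0 < n %/ pdiv n)%N by rewrite divn_gt0 ?prime_gt0 // dvdn_leq.
rewrite -(divnK p_dvd) mulnC; apply: PM => //; apply: IH => //.
by rewrite ltn_Pdiv // prime_gt1.
Qed.

Lemma additive_of_zmod_morphism (G H : zmodType) (f : G -> H) :
  zmod_morphism f -> exists F : {additive G -> H}, F = f :> (G -> H).
Proof.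
move=> fB.
by exists (HB.pack_for {additive G -> H} f (GRing.isZmodMorphism.Build G H f fB)).
Qed.

Section Endomorphisms.
Variables (G : zmodType) (f : {additive G -> G}) (n : nat).

Fact iter_raddfB : zmod_morphism (iter n f).
Proof. by move=> x y; elim: n => //= m ->; rewrite raddfB. Qed.

HB.instance Definition _ :=
  GRing.isZmodMorphism.Build G G (iter n f) iter_raddfB.

Definition mulrn_endo (x : G) : G := x *+ n.

Fact mulrn_endo_is_zmod_morphism : zmod_morphism mulrn_endo.
Proof. exact: mulrnBl. Qed.

HB.instance Definition _ :=
  GRing.isZmodMorphism.Build G G mulrn_endo mulrn_endo_is_zmod_morphism.

End Endomorphisms.

(** * Subgroups *)

Section TrivialAndFull.
Variable G : zmodType.

Definition trivial_subg : {pred G} := fun x => x == 0.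
Definition full_subg : {pred G} := fun=> true.

Fact trivial_subg_closed : zmod_closed trivial_subg.
Proof. by split=> [|x y /eqP-> /eqP->]; rewrite unfold_in ?subrr /=. Qed.

HB.instance Definition _ := GRing.isZmodClosed.Build G trivial_subg trivial_subg_closed.

Fact full_subg_closed : zmod_closed full_subg.
Proof. by []. Qed.

HB.instance Definition _ := GRing.isZmodClosed.Build G full_subg full_subg_closed.

Lemma trivial_subgP x : reflect (x = 0) (x \in trivial_subg).
Proof. exact: eqP. Qed.

End TrivialAndFull.
Arguments trivial_subg {G}.
Arguments full_subg {G}.
Arguments trivial_subgP {G x}.

Section SubgroupOperations.
Variables (G H : zmodType).

Definition cap_subg (A B : {pred G}) : {pred G} := fun x => (x \in A) && (x \in B).

Definition sum_subg (A B : {pred G}) : {pred G} :=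
  fun x => `[< exists2 a, a \in A & x - a \in B >].

Definition image_subg (f : G -> H) (A : {pred G}) : {pred H} :=
  fun y => `[< exists2 x, x \in A & y = f x >].

Definition preim_subg (f : G -> H) (B : {pred H}) : {pred G} := fun x => f x \in B.

Lemma cap_subgP A B x : reflect (x \in A /\ x \in B) (x \in cap_subg A B).
Proof. exact: andP. Qed.

Lemma sum_subgP A B x :
  reflect (exists2 a, a \in A & x - a \in B) (x \in sum_subg A B).
Proof. exact: asboolP. Qed.

Lemma image_subgP f A y : reflect (exists2 x, x \in A & y = f x) (y \in image_subg f A).
Proof. exact: asboolP. Qed.

Lemma mem_image_subg f (A : {pred G}) x : x \in A -> f x \in image_subg f A.
Proof. by move=> Ax; apply/image_subgP; exists x. Qed.

Variables (A B : zmodClosed G) (C : zmodClosed H) (f : {additive G -> H}).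

Fact cap_subg_closed : zmod_closed (cap_subg A B).
Proof.
split=> [|x y /cap_subgP[Ax Bx] /cap_subgP[Ay By]]; apply/cap_subgP.
  by rewrite !rpred0.
by rewrite !rpredB.
Qed.

HB.instance Definition _ := GRing.isZmodClosed.Build G (cap_subg A B) cap_subg_closed.

Fact sum_subg_closed : zmod_closed (sum_subg A B).
Proof.
split=> [|x y /sum_subgP[a Aa Bxa] /sum_subgP[b Ab Byb]]; apply/sum_subgP.
  by exists 0; rewrite ?subrr ?rpred0.
exists (a - b); first by rewrite rpredB.
by rewrite opprD addrACA -opprD rpredB.
Qed.

HB.instance Definition _ := GRing.isZmodClosed.Build G (sum_subg A B) sum_subg_closed.

Fact image_subg_closed : zmod_closed (image_subg f A).
Proof.
split=> [|_ _ /image_subgP[x Ax ->] /image_subgP[y Ay ->]]; apply/image_subgP.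
  by exists 0; rewrite ?raddf0 ?rpred0.
by exists (x - y); rewrite ?raddfB ?rpredB.
Qed.

HB.instance Definition _ := GRing.isZmodClosed.Build H (image_subg f A) image_subg_closed.

Fact preim_subg_closed : zmod_closed (preim_subg f C).
Proof. by split=> [|x y Cx Cy]; rewrite unfold_in ?raddf0 ?raddfB ?rpred0 ?rpredB. Qed.

HB.instance Definition _ := GRing.isZmodClosed.Build G (preim_subg f C) preim_subg_closed.

Lemma mem_sum_subgl x : x \in A -> x \in sum_subg A B.
Proof. by move=> Ax; apply/sum_subgP; exists x; rewrite ?subrr ?rpred0. Qed.

Lemma mem_sum_subgr x : x \in B -> x \in sum_subg A B.
Proof. by move=> Bx; apply/sum_subgP; exists 0; rewrite ?subr0 ?rpred0. Qed.

End SubgroupOperations.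

Section MultiplesAndTorsion.
Variables (G : zmodType) (n : nat).

Definition multiples (A : {pred G}) : {pred G} := image_subg (mulrn_endo n) A.
Definition torsion_by : {pred G} := preim_subg (mulrn_endo n) trivial_subg.

HB.instance Definition _ (A : zmodClosed G) := GRing.ZmodClosed.on (multiples A).
HB.instance Definition _ := GRing.ZmodClosed.on torsion_by.

Lemma multiplesP (A : {pred G}) x :
  reflect (exists2 y, y \in A & x = y *+ n) (x \in multiples A).
Proof. exact: image_subgP. Qed.

Lemma mem_multiples (A : {pred G}) x : x \in A -> x *+ n \in multiples A.
Proof. exact: mem_image_subg. Qed.

Lemma torsion_byP x : reflect (x *+ n = 0) (x \in torsion_by).
Proof. exact: trivial_subgP. Qed.

End MultiplesAndTorsion.
Arguments torsion_by G n : clear implicits.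

Lemma mem_coprime (G : zmodType) (S : zmodClosed G) (m n : nat) x :
  coprime m n -> x *+ m \in S -> x *+ n \in S -> x \in S.
Proof.
move=> /eqP mn_coprime Sm Sn; have [u [v uv]] := Bezoutz m n.
have {uv} uv : u * m + v * n = 1 by rewrite uv /gcdz /= mn_coprime.
rewrite -[x]mulr1z -uv mulrzDr ![_ * Posz _]mulrC !mulrzA.
by rewrite rpredD // rpredMz.
Qed.

Lemma mem_multiples_coprime (G : zmodType) (S : zmodClosed G) (m n : nat) x :
  coprime m n -> x \in S -> x *+ n \in multiples m S -> x \in multiples m S.
Proof. by move=> mn_coprime Sx; apply/(mem_coprime mn_coprime)/mem_multiples. Qed.

Lemma mem_of_prime_multiple (G : zmodType) (S : {pred G}) :
  (forall (p : nat) x, prime p -> x *+ p \in S -> x \in S) ->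
  forall (n : nat) x, (0 < n)%N -> x *+ n \in S -> x \in S.
Proof.
move=> Sp n x n_gt0; elim/prime_mul_ind: n_gt0 x => // p m p_prime _ IH x.
by rewrite mulrnA => /IH; apply: Sp.
Qed.

Definition divisible (G : zmodType) (S : {pred G}) :=
  forall p : nat, prime p -> {subset S <= multiples p S}.

Section Divisibility.
Variables (G : zmodType) (S : zmodClosed G).
Hypothesis divS : divisible S.

Lemma divisible_multiples n : (0 < n)%N -> {subset S <= multiples n S}.
Proof.
move=> n_gt0; elim/prime_mul_ind: n_gt0 => [|p m p_prime _ IH] x Sx.
  by apply/multiplesP; exists x.
have /multiplesP[y /(divS p_prime)/multiplesP[z Sz ->] ->] := IH _ Sx.
by apply/multiplesP; exists z; rewrite // mulrnA.
Qed.

Lemma divisible_mulrz (m : int) x : m != 0 -> x \in S ->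
  exists2 y, y \in S & x = y *~ m.
Proof.
case: m => n n_neq0 Sx.
  by apply/multiplesP; apply: divisible_multiples Sx; rewrite // lt0n.
have /multiplesP[y Sy xE] := divisible_multiples (ltn0Sn n) Sx.
by exists (- y); rewrite ?rpredN // NegzE mulrNz mulNrz opprK.
Qed.

End Divisibility.

(** * Complements and extension of homomorphisms *)

Lemma subgroup_chain_union (G : zmodType) (F : set (zmodClosed G)) :
  (exists C, F C) -> total_on F (fun C D => {subset C <= D}) ->
  exists U : zmodClosed G, forall x, x \in U <-> exists2 C, F C & x \in C.
Proof.
move=> [C0 FC0] F_total.
pose U : {pred G} := fun x => `[< exists2 C, F C & x \in C >].
have U_closed : zmod_closed U.
  split=> [|x y /asboolP[C FC Cx] /asboolP[D FD Dy]]; apply/asboolP.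
    by exists C0; rewrite ?rpred0.
  have [CD|DC] := F_total C D FC FD; first by exists D; rewrite // rpredB // CD.
  by exists C; rewrite // rpredB // DC.
exists (HB.pack_for (zmodClosed G) U (GRing.isZmodClosed.Build G U U_closed)) => x.
by split=> /asboolP.
Qed.

Definition meets_trivially (G : zmodType) (A B : {pred G}) :=
  forall x, x \in A -> x \in B -> x = 0.

(* When [B] and [C] are subgroups: [(B + C) / C] is an essential subgroup of [G / C]. *)
Definition essential_mod (G : zmodType) (B C : {pred G}) := forall x, x \notin C ->
  exists n c, [/\ c \in C, x *+ n - c \in B & x *+ n - c != 0].

Section Complements.
Variables (G : zmodType) (B : zmodClosed G).

Lemma exists_maximal_disjoint (K : zmodClosed G) : meets_trivially K B ->
  exists C : zmodClosed G, [/\ {subset K <= C}, meets_trivially C B &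
    forall D : zmodClosed G, {subset C <= D} -> meets_trivially D B -> {subset D <= C}].
Proof.
move=> KB.
pose T := {C : zmodClosed G | {subset K <= C} /\ meets_trivially C B}.
pose K0 : T := exist _ K (conj (fun=> id) KB).
pose le (C D : T) := `[< {subset sval C <= sval D} >].
have [||chain chain_total|[C [KC CB]] maxC] := @ZL_preorder T K0 le.
- by move=> C; apply/asboolP.
- by move=> C D E /asboolP CD /asboolP DE; apply/asboolP => x /CD/DE.
- have [[C0 chainC0]|chain0] := pselect (exists C, chain C); last first.
    by exists K0 => C chainC; case: chain0; exists C.
  have [||U UP] := @subgroup_chain_union _ [set sval C | C in chain]%classic.
  + by exists (sval C0), C0.
  + move=> _ _ [C chainC <-] [D chainD <-].
    by have [/asboolP|/asboolP] := chain_total C D chainC chainD; [left|right].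
  have KU : {subset K <= U}.
    move=> x Kx; apply/UP; exists (sval C0); first by exists C0.
    by have [KC0 _] := svalP C0; apply: KC0.
  have UB : meets_trivially U B.
    by move=> x /UP[_ [C _ <-] Cx]; have [_ CB] := svalP C; apply: CB.
  exists (exist _ U (conj KU UB)) => C chainC; apply/asboolP => x Cx.
  by apply/UP; exists (sval C) => //; exists C.
exists C; split=> // D CD DB; have KD : {subset K <= D} by move=> x /KC/CD.
by have /(_ (asboolT CD))/asboolP := maxC (exist _ D (conj KD DB)).
Qed.

Lemma maximal_disjoint_essential (C : zmodClosed G) :
  (forall D : zmodClosed G, {subset C <= D} -> meets_trivially D B -> {subset D <= C}) ->
  essential_mod B C.
Proof.
move=> maxC x nCx; pose D := sum_subg (image_subg (intmul x) full_subg) C.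
have Dx : x \in D.
  by apply: mem_sum_subgl; rewrite -[x]mulr1z; apply: mem_image_subg.
have /existsNP[y /not_implyP[Dy /not_implyP[By y_neq0]]] : ~ meets_trivially D B.
  by move=> /maxC CD; move: nCx; rewrite CD // => z; apply: mem_sum_subgr.
move/sum_subgP: Dy => [_ /image_subgP[m _ ->] Cym].
case: m Cym => n Cyn.
  exists n, (x *+ n - y); rewrite subKr -opprB rpredN.
  by split=> //; apply/eqP.
exists n.+1, (y + x *+ n.+1); rewrite opprD addrCA subrr addr0 rpredN oppr_eq0.
rewrite NegzE mulrNz opprK in Cyn.
by split=> //; apply/eqP.
Qed.

Lemma exists_essential_complement (K : zmodClosed G) : meets_trivially K B ->
  exists C : zmodClosed G, [/\ {subset K <= C}, meets_trivially C B & essential_mod B C].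
Proof.
move=> /exists_maximal_disjoint[C [KC CB maxC]]; exists C; split=> //.
exact: maximal_disjoint_essential.
Qed.

Lemma essential_complement (C : zmodClosed G) :
  meets_trivially C B -> essential_mod B C ->
  (forall (p : nat) x b c, prime p -> b \in B -> c \in C -> x *+ p = b + c ->
    b \in multiples p B) ->
  forall x, x \in sum_subg B C.
Proof.
move=> CB essC divB x.
have scale_in n y c : c \in C -> y *+ n - c \in B -> y *+ n \in sum_subg B C.
  by move=> Cc Bync; apply/sum_subgP; exists (y *+ n - c); rewrite // subKr.
have BC_prime (p : nat) y : prime p -> y *+ p \in sum_subg B C -> y \in sum_subg B C.
  move=> p_prime /sum_subgP[b Bb Cyb].
  have /multiplesP[b' Bb' bE] : b \in multiples p B.
    by apply: (divB p y b (y *+ p - b)); rewrite // addrC subrK.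
  suff : y - b' \in sum_subg B C by rewrite rpredBr // mem_sum_subgl.
  have Cyb' : (y - b') *+ p \in C by rewrite mulrnBl -bE.
  have [Cy|nCy] := boolP (y - b' \in C); first exact: mem_sum_subgr.
  have [n [c [Cc Bync ync_neq0]]] := essC _ nCy.
  apply: (@mem_coprime _ (sum_subg B C) p n);
    [|exact: mem_sum_subgr|exact: scale_in Bync].
  rewrite prime_coprime //; apply/negP => /dvdnP[k nE].
  by case/eqP: ync_neq0; apply: CB; rewrite // nE mulnC mulrnA rpredB // rpredMn.
have [Cx|nCx] := boolP (x \in C); first exact: mem_sum_subgr.
have [n [c [Cc Bxnc xnc_neq0]]] := essC _ nCx.
apply: (mem_of_prime_multiple BC_prime) (scale_in _ _ _ Cc Bxnc).
rewrite lt0n; apply/eqP => n_eq0.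
by case/eqP: xnc_neq0; apply: CB; rewrite // n_eq0 sub0r rpredN.
Qed.

End Complements.

Section GraphsOfAdditiveMaps.
Variables G H : zmodType.

Lemma additive_of_graph (R : zmodClosed (G * H)%type) :
  (forall x, exists y, (x, y) \in R) -> (forall y, (0, y) \in R -> y = 0) ->
  exists f : {additive G -> H}, forall x y, (x, y) \in R -> f x = y.
Proof.
move=> R_total R_functional; have [f Rf] := choice R_total.
have fE x y : (x, y) \in R -> f x = y.
  move=> Rxy; apply/subr0_eq/R_functional.
  by rewrite -[0](subrr x); apply: rpredB (Rf x) Rxy.
have [|F FE] := @additive_of_zmod_morphism G H f; last by exists F; rewrite FE.
by move=> x y; apply: fE; apply: rpredB (Rf x) (Rf y).
Qed.

(* A subgroup of [G * H] that contains [R] and is a complement of [0 * E] is the graph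
   of an extension of [R] to [G]. *)
Lemma divisible_extension (E : zmodClosed H) (R : zmodClosed (G * H)%type) :
  divisible E -> (forall y, (0, y) \in R -> y = 0) ->
  (forall x y, (x, y) \in R -> y \in E) ->
  exists f : {additive G -> H},
    (forall x y, (x, y) \in R -> f x = y) /\ forall x, f x \in E.
Proof.
move=> divE R_functional R_range.
pose B := cap_subg (preim_subg fst trivial_subg) (preim_subg snd E) : {pred G * H}.
have BP x y : reflect (x = 0 /\ y \in E) ((x, y) \in B).
  by apply: (iffP (cap_subgP _ _ _)) => -[/eqP].
have [|C [RC CB essC]] := @exists_essential_complement _ B R.
  by move=> [x y] Rxy /BP[x0 _]; rewrite x0 in Rxy *; rewrite (R_functional y).
have pairMn e n : (0, e) *+ n = (0, e *+ n) :> G * H.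
  by elim: n => // n IH; rewrite !mulrS IH; congr pair; rewrite /= addr0.
have BC_full x : exists2 y, y \in E & (x, y) \in C.
  have : (x, 0) \in sum_subg B C.
    apply: essential_complement => // p z [_ b] c p_prime /BP[-> /(divE p p_prime)].
    case/multiplesP=> e Ee -> _ _; apply/multiplesP.
    by exists (0, e); [apply/BP|rewrite -pairMn].
  case/sum_subgP=> [[_ e] /BP[-> Ee] Cxe]; exists (- e); first by rewrite rpredN.
  suff -> : (x, - e) = (x, 0) - (0, e) by [].
  by congr pair; rewrite /= ?subr0 ?sub0r.
pose F := cap_subg (preim_subg snd E) C : {pred G * H}.
have FP x y : reflect (y \in E /\ (x, y) \in C) ((x, y) \in F).
  by apply: (iffP (cap_subgP _ _ _)).
have [x|y|f fP] := @additive_of_graph F.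
- by have [y Ey Cxy] := BC_full x; exists y; apply/FP.
- by case/FP=> Ey C0y; have [] : (0, y) = 0 :> G * H by apply: CB => //; apply/BP.
exists f; split=> [x y Rxy|x].
  by apply/fP/FP; split; [exact: R_range Rxy|exact: RC].
by have [y Ey Cxy] := BC_full x; rewrite (fP x y) //; apply/FP.
Qed.

End GraphsOfAdditiveMaps.

Lemma projection_of_complement (G : zmodType) (A C : zmodClosed G) :
  meets_trivially A C -> (forall x, x \in sum_subg A C) ->
  exists pi : {additive G -> G}, (forall x, pi x \in A) /\ {in A, forall x, pi x = x}.
Proof.
move=> AC AC_full.
pose R := cap_subg (preim_subg snd A) (preim_subg (fst \- snd) C) : {pred G * G}.
have RP x y : reflect (y \in A /\ x - y \in C) ((x, y) \in R).
  by apply: (iffP (cap_subgP _ _ _)).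
have [|y|pi piP] := @additive_of_graph G G R.
- by move=> x; have /sum_subgP[y Ay Cxy] := AC_full x; exists y; apply/RP.
- by case/RP=> Ay; rewrite sub0r rpredN => /(AC _ Ay).
exists pi; split=> x.
  by have /sum_subgP[y Ay Cxy] := AC_full x; rewrite (piP x y) //; apply/RP.
by move=> Ax; apply: piP; apply/RP; rewrite subrr rpred0.
Qed.

(** * Stabilisation of endomorphisms *)

(* For [f]-invariant subgroups [Y] and [S] with [Y <= S]: the powers [n] and [n.+1] of the
   endomorphism of [S / Y] induced by [f] have the same image. *)
Definition stable_mod (G : zmodType) (S Y : {pred G}) (f : G -> G) (n : nat) :=
  {in S, forall x, exists2 y, y \in S & iter n f x - iter n.+1 f y \in Y}.

Notation stable_on S := (stable_mod S trivial_subg).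

Definition invariant_under (G : zmodType) (S : {pred G}) (f : G -> G) :=
  {in S, forall x, f x \in S}.

Lemma trivial_invariant (G : zmodType) (f : {additive G -> G}) :
  invariant_under trivial_subg f.
Proof. by move=> x /trivial_subgP->; rewrite raddf0 rpred0. Qed.

Lemma iter_invariant (G : zmodType) (S : {pred G}) (f : G -> G) n :
  invariant_under S f -> invariant_under S (iter n f).
Proof. by move=> fS x Sx; elim: n => //= n; apply: fS. Qed.

Section Stabilisation.
Variables (G : zmodType) (S Y : zmodClosed G) (f : {additive G -> G}).

Lemma stable_onP n : stable_on S f n <->
  {in S, forall x, exists2 y, y \in S & iter n f x = iter n.+1 f y}.
Proof.
split=> stable x /stable[y Sy]; first by move/trivial_subgP/subr0_eq; exists y.
by move=> ->; exists y; rewrite // subrr rpred0.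
Qed.

Lemma stable_mod_iter n : invariant_under Y f -> stable_mod S Y f n ->
  forall k, {in S, forall x, exists2 y, y \in S & iter n f x - iter (n + k) f y \in Y}.
Proof.
move=> fY stable; elim=> [|k IH] x Sx; first by exists x; rewrite // addn0 subrr rpred0.
have [y Sy Yxy] := IH x Sx; have [z Sz Yyz] := stable y Sy; exists z => //.
rewrite -[iter n f x](subrK (iter (n + k) f y)) -addrA rpredD //.
by rewrite [(n + k)%N]addnC [(n + k.+1)%N]addnC addSnnS !iterD -raddfB iter_invariant.
Qed.

Lemma stable_mod_leq m n : invariant_under Y f -> (m <= n)%N ->
  stable_mod S Y f m -> stable_mod S Y f n.
Proof.
move=> fY m_le_n stable x /stable[y Sy Yxy]; exists y => //.
by rewrite -(subnK m_le_n) -addnS !iterD -raddfB iter_invariant.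
Qed.

Lemma unstable_sequence n : invariant_under Y f -> ~ stable_mod S Y f n ->
  exists x : nat -> G, forall j, x j \in S /\
    ((j <= n)%N -> {in S, forall y, iter j f (x j) - iter j.+1 f y \notin Y}).
Proof.
move=> fY unstable; suff /choice[x] : forall j, exists x, x \in S /\
    ((j <= n)%N -> {in S, forall y, iter j f x - iter j.+1 f y \notin Y}) by exists x.
move=> j; have [j_le|_] := leqP j n; last first.
  by exists 0; rewrite rpred0.
apply: contrapT => no_x; apply: unstable; apply: (stable_mod_leq fY j_le) => x Sx.
apply: contrapT => no_y; apply: no_x; exists x; split=> // _ y Sy.
by apply/negP => Yxy; apply: no_y; exists y.
Qed.

End Stabilisation.

Lemma stable_mod_trans (G : zmodType) (S Y Z : zmodClosed G) (f : {additive G -> G}) m n :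
  {subset Y <= S} -> invariant_under Z f ->
  stable_mod S Y f m -> stable_mod Y Z f n -> stable_mod S Z f (m + n).
Proof.
move=> YS fZ stableS stableY x /stableS[y Sy /(stable_mod_iter fZ stableY)].
move=> /(_ m.+1)[z Yz]; rewrite iter_raddfB -!iterD -addrA -opprD.
rewrite addnS [(n + m)%N]addnC -raddfD => Zxyz.
by exists (y + z) => //; rewrite rpredD // YS.
Qed.

Section CoHopfian.
Variable G : zmodType.

Lemma same_img_iterP (S : G -> Prop) (f : G -> G) n : (forall x, S x -> S (f x)) ->
  same_set (img (iter n f) S) (img (iter n.+1 f) S) <->
  forall x, S x -> exists2 y, S y & iter n f x = iter n.+1 f y.
Proof.
move=> fS; split=> [eq_img x Sx|stable x]; first by apply/eq_img; exists x.
split=> [[y Sy ->]|[y Sy ->]]; first exact: stable.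
by exists (f y); rewrite ?iterSr //; apply: fS.
Qed.

Lemma stable_fullP (f : {additive G -> G}) n :
  same_set (img (iter n f) (@whole G)) (img (iter n.+1 f) (@whole G)) <->
  stable_on full_subg f n.
Proof.
rewrite same_img_iterP // stable_onP; split=> stable x _.
  by have [//|y _ xE] := stable x; exists y.
by have [//|y _ xE] := stable x; exists y.
Qed.

Lemma endo_whole (f : {additive G -> G}) : endo_on (@whole G) f.
Proof. by split=> // x y _ _; apply: raddfD. Qed.

Lemma additive_of_endo_whole (f : G -> G) :
  endo_on (@whole G) f -> exists F : {additive G -> G}, F = f :> (G -> G).
Proof.
case=> _ fD; apply: additive_of_zmod_morphism => x y.
by apply/eqP; rewrite eq_sym subr_eq -fD // subrK.
Qed.

Lemma strongly_coHopfianP : strongly_coHopfian G <->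
  forall f : {additive G -> G}, exists n, stable_on full_subg f n.
Proof.
split=> [coHopf f|coHopf f /additive_of_endo_whole[F <-]].
  by have [n /stable_fullP] := coHopf f (endo_whole f); exists n.
by have [n /stable_fullP] := coHopf F; exists n.
Qed.

Lemma uniformly_strongly_coHopfianP : uniformly_strongly_coHopfian G <->
  exists n, forall f : {additive G -> G}, stable_on full_subg f n.
Proof.
split=> -[n coHopf]; exists n => f; last first.
  by move=> /additive_of_endo_whole[F <-]; apply/stable_fullP.
exact/stable_fullP/coHopf/endo_whole.
Qed.

End CoHopfian.

Section FiniteQuotients.
Variable G : zmodType.

Definition finite_mod (X Y : {pred G}) :=
  exists L : seq G, {in X, forall x, exists2 y, y \in L & x - y \in Y}.

Lemma finite_mod_trivialP (X : {pred G}) :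
  finite_mod X trivial_subg <-> exists L : seq G, {subset X <= L}.
Proof.
split=> -[L LP]; exists L => x Xx; last by exists x; rewrite ?LP // subrr rpred0.
by have [y Ly /trivial_subgP/subr0_eq ->] := LP x Xx.
Qed.

Lemma finite_mod_sum_subg (X A Y : {pred G}) :
  {subset X <= sum_subg A Y} -> finite_mod A trivial_subg -> finite_mod X Y.
Proof.
move=> X_sum /finite_mod_trivialP[L AL]; exists L => x /X_sum/sum_subgP[a Aa Yxa].
by exists a; rewrite ?AL.
Qed.

Variables X Y Z : zmodClosed G.

Lemma finite_mod_trans :
  finite_mod X Y -> finite_mod (cap_subg X Y) Z -> finite_mod X Z.
Proof.
move=> [L LP] [L' L'P].
have /choice[r rP] : forall y, exists r,
    (exists2 x, x \in X & x - y \in Y) -> r \in X /\ r - y \in Y.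
  move=> y; have [[x Xx Yx]|no_x] := pselect (exists2 x, x \in X & x - y \in Y).
    by exists x.
  by exists 0.
exists [seq r y + z | y <- L, z <- L'] => x Xx; have [y Ly Yxy] := LP x Xx.
have [Xr Yr] := rP y (ex_intro2 _ _ x Xx Yxy).
have [|z L'z Zxz] := L'P (x - r y).
  apply/cap_subgP; split; first exact: rpredB.
  by rewrite -[x - r y](subrKA y) -[y - r y]opprB rpredB.
by exists (r y + z); [apply: allpairs_f|rewrite opprD addrA].
Qed.

Lemma finite_mod_pigeonhole : finite_mod X Y ->
  exists n, forall u : nat -> G, (forall i, u i \in X) ->
    exists i j, [/\ (i < j)%N, (j <= n)%N & u i - u j \in Y].
Proof.
move=> [L LP]; exists (size L) => u Xu.
have /choice[r rP] : forall i, exists y, y \in L /\ u i - y \in Y.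
  by move=> i; have [y Ly Yuy] := LP _ (Xu i); exists y.
have : ~~ uniq (mkseq r (size L).+1).
  apply/negP => r_uniq; have : (size (mkseq r (size L).+1) <= size L)%N.
    by apply: uniq_leq_size r_uniq _ => _ /mapP[i _ ->]; case: (rP i).
  by rewrite size_mkseq ltnn.
move=> /(uniqPn 0)[i [j [i_lt_j]]]; rewrite size_mkseq => j_le.
rewrite !nth_mkseq ?(ltn_trans i_lt_j) // => r_ij; exists i, j; split=> //.
have [[_ Yi] [_ Yj]] := (rP i, rP j).
by rewrite -[u i - u j](subrKA (r i)) {2}r_ij -[r j - u j]opprB rpredB.
Qed.

Lemma finite_mod_stable : finite_mod X Y ->
  exists n, forall f : {additive G -> G}, invariant_under X f -> invariant_under Y f ->
    stable_mod X Y f n.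
Proof.
move=> /finite_mod_pigeonhole[n pigeonhole]; exists n => f fX fY.
apply: contrapT => unstable.
have [x xP] := unstable_sequence fY unstable.
have [|i [j [i_lt_j j_le]]] := pigeonhole (fun j => iter j f (x j)).
  by move=> j; apply: iter_invariant => //; case: (xP j).
have [[_ /(_ (leq_trans (ltnW i_lt_j) j_le)) x_bad] [Xxj _]] := (xP i, xP j).
have -> : iter j f (x j) = iter i.+1 f (iter (j - i.+1) f (x j)) by rewrite -iterD subnKC.
by apply/negP/x_bad/iter_invariant.
Qed.

Lemma finite_mod_kernel_stationary (f : {additive G -> G}) :
  finite_mod X Y -> invariant_under Y f ->
  exists m, {in X, forall x, iter m.+1 f x \in Y -> iter m f x \in Y}.
Proof.
move=> /finite_mod_pigeonhole[n pigeonhole] fY; apply: contrapT => no_m.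
have /choice[u uP] j : exists x, [/\ x \in X, iter j.+1 f x \in Y & iter j f x \notin Y].
  apply: contrapT => no_x; apply: no_m; exists j => x Xx Yx.
  by apply: contrapT => /negP nYx; apply: no_x; exists x.
have [|i [j [i_lt_j _ Yuij]]] := pigeonhole u; first by move=> i; case: (uP i).
have [[_ Yui _] [_ _ /negP]] := (uP i, uP j); apply.
rewrite -[u j](subKr (u i)) iter_raddfB rpredB //; last by rewrite iter_invariant.
by rewrite -(subnK i_lt_j) iterD iter_invariant.
Qed.

Lemma finite_mod_kernel_stable (f : {additive G -> G}) N n : finite_mod X Y ->
  invariant_under X f -> invariant_under Y f -> stable_mod X Y f N ->
  {in X, forall x, iter n f x \in Y -> iter N f x \in Y}.
Proof.
move=> XY_finite fX fY stable x Xx Yx.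
have [m kernel_m] := finite_mod_kernel_stationary XY_finite fY.
have kernel_ge k : {in X, forall y, iter (k + m) f y \in Y -> iter m f y \in Y}.
  elim: k => // k IH y Xy; rewrite addSn iterSr => /(IH (f y) (fX y Xy)).
  by rewrite -iterSr; apply: kernel_m.
have [y Xy Yxy] := stable_mod_iter fY stable m Xx.
rewrite -[iter N f x](subrK (iter (N + m) f y)) rpredD // iterD iter_invariant //.
apply: (kernel_ge (n + N)%N) => //; rewrite -addnA iterD.
rewrite -[iter (N + m) f y](subKr (iter N f x)) iter_raddfB.
rewrite rpredB //; last by rewrite iter_invariant.
by rewrite -iterD addnC iterD iter_invariant.
Qed.

End FiniteQuotients.

(** * Integral combinations of a sequence *)

Section Lincomb.
Variables (G : zmodType) (s : nat -> G).
Implicit Types q : {poly int}.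

(* A polynomial over [int] encodes a finitely supported family of coefficients, so that
   multiplication by ['X] is the shift of families. *)
Definition lincomb q : G := \sum_(i < size q) s i *~ q`_i.

Lemma lincomb_widen n q : (size q <= n)%N -> lincomb q = \sum_(i < n) s i *~ q`_i.
Proof.
move=> q_le; rewrite /lincomb (big_ord_widen _ (fun i => s i *~ q`_i) q_le) big_mkcond.
apply: eq_bigr => i _; case: ltnP => // /(nth_default 0) ->.
by rewrite mulr0z.
Qed.

Fact lincomb_is_zmod_morphism : zmod_morphism lincomb.
Proof.
move=> q r; set n := maxn (size q) (size r).
rewrite !(@lincomb_widen n) ?leq_maxl ?leq_maxr //; last first.
  by rewrite (leq_trans (size_polyD _ _)) // size_polyN.
by rewrite -sumrB; apply: eq_bigr => i _; rewrite coefB mulrzBr.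
Qed.

HB.instance Definition _ :=
  GRing.isZmodMorphism.Build {poly int} G lincomb lincomb_is_zmod_morphism.

Lemma lincombZ a q : lincomb (a *: q) = lincomb q *~ a.
Proof. by rewrite -raddfMz -scaler_int intz. Qed.

Lemma lincombXn n : lincomb 'X^n = s n.
Proof.
rewrite (@lincomb_widen n.+1) ?size_polyXn // big_ord_recr /= coefXn eqxx.
by rewrite big1 ?add0r // => i _; rewrite coefXn ltn_eqF.
Qed.

Lemma lincomb_take n q : (size q <= n.+1)%N ->
  lincomb q = lincomb (take_poly n q) + s n *~ q`_n.
Proof.
move=> /lincomb_widen->; rewrite big_ord_recr (lincomb_widen (size_take_poly n q)) /=.
by congr (_ + _); apply: eq_bigr => i _; rewrite coef_take_poly ltn_ord.
Qed.

Definition span : {pred G} := image_subg lincomb full_subg.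
HB.instance Definition _ := GRing.ZmodClosed.on span.

Lemma spanP x : reflect (exists q, x = lincomb q) (x \in span).
Proof. by apply: (iffP (image_subgP _ _ _)) => [[q _]|[q]]; exists q. Qed.

Lemma mem_span q : lincomb q \in span.
Proof. by apply/spanP; exists q. Qed.

Lemma span_sub (S : zmodClosed G) : (forall i, s i \in S) -> {subset span <= S}.
Proof. by move=> Ss _ /spanP[q ->]; apply: rpred_sum => i _; rewrite rpredMz. Qed.

End Lincomb.

Lemma lincomb_shift (G : zmodType) (s : nat -> G) n q :
  lincomb (fun i => s (i + n)%N) q = lincomb s (q * 'X^n).
Proof.
rewrite (@lincomb_widen _ s (n + size q)); last first.
  by rewrite (leq_trans (size_polyMleq _ _)) // size_polyXn addnC.
rewrite big_split_ord /= big1 ?add0r => [|i _]; last by rewrite coefMXn ltn_ord mulr0z.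
by apply: eq_bigr => i _; rewrite coefMXn ltnNge leq_addr addKn addnC.
Qed.

Lemma lincomb_lowest (G : zmodType) (s : nat -> G) n (q : {poly int}) :
  (forall i, (i < n)%N -> q`_i = 0) ->
  lincomb s q = s n *~ q`_n + lincomb (fun i => s (i + n.+1)%N) (drop_poly n.+1 q).
Proof.
move=> q_low; rewrite lincomb_shift -{1}(poly_take_drop n.+1 q) raddfD /=.
congr (_ + _); rewrite -lincombXn -lincombZ; congr lincomb; apply/polyP => i.
rewrite coef_take_poly coefZ coefXn ltnS.
by case: ltngtP => [/q_low||->]; rewrite ?mulr0 ?mulr1.
Qed.

Lemma raddf_lincomb (G H : zmodType) (f : {additive G -> H}) (s : nat -> G) q :
  f (lincomb s q) = lincomb (f \o s) q.
Proof. by rewrite raddf_sum; apply: eq_bigr => i _; rewrite raddfMz. Qed.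

Lemma lincomb_in_span_mkseq (G : zmodType) (s : nat -> G) n (q : {poly int}) :
  (size q <= n)%N -> lincomb s q \in span (nth 0 (mkseq s n)).
Proof.
move=> q_le; apply/spanP; exists q; apply: eq_bigr => i _.
by rewrite nth_mkseq // (leq_trans (ltn_ord i)).
Qed.

Lemma lincomb_nth (G : zmodType) (l : seq G) (q : {poly int}) :
  lincomb (nth 0 l) q = \sum_(i < size l) l`_i *~ q`_i.
Proof.
pose n := maxn (size q) (size l).
rewrite (@lincomb_widen _ _ n) ?leq_maxl //.
rewrite (big_ord_widen _ (fun i => l`_i *~ q`_i) (leq_maxr (size q) (size l))).
rewrite [RHS]big_mkcond; apply: eq_bigr => i _; case: ltnP => // l_le.
by rewrite nth_default ?mul0rz.
Qed.

(** * Independent sequences *)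

(* For a family of elements of order [d] and [Y] trivial: the family is a basis of a
   direct sum of copies of [Z/d], with [Z/0 = Z]. *)
Definition independent_mod (G : zmodType) (d : nat) (Y : {pred G}) (s : nat -> G) :=
  forall q : {poly int}, lincomb s q \in Y -> q \is a polyOver (dvdz d).

Section Independence.
Variables (G : zmodType) (d : nat) (s : nat -> G).
Hypothesis sd0 : forall i, s i *+ d = 0.

Lemma lincomb_eq0 q : q \is a polyOver (dvdz d) -> lincomb s q = 0.
Proof.
move=> /polyOverP d_dvd_q; apply: big1 => i _; have /dvdzP[k ->] := d_dvd_q i.
by rewrite mulrC mulrzA -pmulrn sd0 mul0rz.
Qed.

Lemma independent_mod_of_leading (Y : {pred G}) :
  (forall n m (q : {poly int}), (size q <= n)%N ->
    lincomb s q + s n *~ m \in Y -> (d %| m)%Z) ->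
  independent_mod d Y s.
Proof.
move=> leading q; have [n] := ubnP (size q).
elim: n q => // n IH q; rewrite ltnS => q_le Yq.
apply/polyOverP; have Yq' := Yq; case: n => [|n] in IH q_le Yq'.
  by move/leq_sizeP: q_le => q0 i; rewrite q0 // dvdz0.
rewrite (lincomb_take s q_le) in Yq'.
have d_dvd_qn := leading _ _ _ (size_take_poly n q) Yq'.
have /polyOverP d_dvd_take : take_poly n q \is a polyOver (dvdz d).
  apply: IH; first exact: size_take_poly.
  move: Yq'; have /dvdzP[k ->] := d_dvd_qn.
  by rewrite mulrC mulrzA -pmulrn sd0 mul0rz addr0.
move=> i; have := d_dvd_take i; rewrite coef_take_poly.
case: ltngtP => // [n_lt_i|-> //] _.
by rewrite nth_default ?dvdz0 // (leq_trans q_le).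
Qed.

End Independence.

Lemma independent_mod_prime (G : zmodType) (p : nat) (Y : zmodClosed G) (s : nat -> G) :
  prime p -> (forall i, s i *+ p = 0) ->
  (forall n, s n \notin sum_subg (span (nth 0 (mkseq s n))) Y) -> independent_mod p Y s.
Proof.
move=> p_prime sp0 s_notin; apply: independent_mod_of_leading => // n m q q_le Yqm.
apply: contrapT => /negP p_ndvd_m; have /eqP pm_coprime : coprimez p m.
  by rewrite coprimezE prime_coprime // -dvdzE.
have [u [v uv]] := Bezoutz p m; rewrite pm_coprime in uv.
have snE : s n *~ (v * m) = s n.
  by rewrite -[RHS]mulr1z -uv mulrzDr (mulrC u) (mulrzA _ _ u) -pmulrn sp0 mul0rz add0r.
case/negP: (s_notin n); apply/sum_subgP; exists (lincomb s q *~ (- v)).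
  by rewrite rpredMz // lincomb_in_span_mkseq.
by rewrite mulrNz opprK -{1}snE mulrC mulrzA -mulrzDl addrC rpredMz.
Qed.

Section PureClosure.
Variables (G : zmodType) (S : zmodClosed G).

Definition pure_closure : {pred G} := fun x => `[< exists2 n, (0 < n)%N & x *+ n \in S >].

Lemma pure_closureP x :
  reflect (exists2 n, (0 < n)%N & x *+ n \in S) (x \in pure_closure).
Proof. exact: asboolP. Qed.

Fact pure_closure_closed : zmod_closed pure_closure.
Proof.
split=> [|x y /pure_closureP[m m_gt0 Sx] /pure_closureP[n n_gt0 Sy]]; apply/pure_closureP.
  by exists 1%N; rewrite ?mul0rn ?rpred0.
exists (m * n)%N; first by rewrite muln_gt0 m_gt0.
by rewrite mulrnBl mulrnA [(m * n)%N]mulnC mulrnA rpredB // rpredMn.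
Qed.

HB.instance Definition _ := GRing.isZmodClosed.Build G pure_closure pure_closure_closed.

Lemma sub_pure_closure : {subset S <= pure_closure}.
Proof. by move=> x Sx; apply/pure_closureP; exists 1%N. Qed.

Lemma pure_closureMz x (m : int) :
  m != 0 -> x *~ m \in pure_closure -> x \in pure_closure.
Proof.
case: m => k k_neq0 /pure_closureP[n n_gt0 Sxkn]; apply/pure_closureP.
  by exists (k * n)%N; rewrite ?muln_gt0 ?mulrnA // lt0n k_neq0.
exists (k.+1 * n)%N; first by rewrite muln_gt0.
by rewrite mulrnA -rpredN -mulNrn.
Qed.

End PureClosure.

Lemma independent_of_not_pure_closure (G : zmodType) (s : nat -> G) :
  (forall n, s n \notin pure_closure (span (nth 0 (mkseq s n)))) ->
  independent_mod 0 trivial_subg s.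
Proof.
move=> s_notin; apply: independent_mod_of_leading => // n m q q_le /trivial_subgP qm0.
rewrite dvd0z; apply: contraNT (s_notin n) => m_neq0.
have /eqP snE : s n *~ m == - lincomb s q by rewrite -addr_eq0 addrC qm0.
apply/(pure_closureMz m_neq0)/sub_pure_closure; rewrite snE.
by rewrite rpredN lincomb_in_span_mkseq.
Qed.

Lemma exhaust_or_sequence (T : eqType) (X : {pred T}) (Cl : seq T -> {pred T}) :
  (exists2 l, {subset l <= X} & {subset X <= Cl l}) \/
  (exists s : nat -> T, forall n, s n \in X /\ s n \notin Cl (mkseq s n)).
Proof.
have [|no_list] := pselect (exists2 l, {subset l <= X} & {subset X <= Cl l}).
  by left.
right.
have new_element l : {subset l <= X} -> exists y, y \in X /\ y \notin Cl l.
  move=> lX; apply: contrapT => no_y; apply: no_list; exists l => // y Xy.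
  by apply: contrapT => /negP Cly; apply: no_y; exists y.
have [//|x0 _] := new_element [::].
have /choice[next nextP] l :
    exists y, {subset l <= X} -> y \in X /\ y \notin Cl l.
  have [/new_element[y yP]|no_lX] := pselect {subset l <= X}; first by exists y.
  by exists x0.
pose fix prefix n := if n is m.+1 then rcons (prefix m) (next (prefix m)) else [::].
have prefixX n : {subset prefix n <= X}.
  elim: n => //= n IH x; rewrite mem_rcons inE => /orP[/eqP->|/IH //].
  by have [] := nextP _ IH.
exists (fun n => next (prefix n)) => n.
have -> : mkseq (fun n => next (prefix n)) n = prefix n.
  by elim: n => // n IH; rewrite mkseqS IH.
exact: nextP (prefixX n).
Qed.

Lemma finite_mod_span (G : zmodType) (p : nat) (l : seq G)
    (X : {pred G}) (Y : zmodClosed G) :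
  (0 < p)%N -> {subset l <= torsion_by G p} ->
  {subset X <= sum_subg (span (nth 0 l)) Y} -> finite_mod X Y.
Proof.
move=> p_gt0 lp0 X_span; have p_neq0 : p != 0 :> int by rewrite -lt0n.
exists (codom (fun c : {ffun 'I_(size l) -> 'I_p} => \sum_(i < size l) l`_i *+ c i)).
move=> x /X_span/sum_subgP[_ /spanP[q ->] Yxq]; exists (lincomb (nth 0 l) q) => //.
have rem_lt i : (`|(q`_i %% p)%Z| < p)%N.
  by rewrite -ltz_nat gez0_abs ?modz_ge0 ?ltz_pmod.
apply/codomP; exists [ffun i : 'I_(size l) => Ordinal (rem_lt i)].
rewrite lincomb_nth; apply: eq_bigr => i _; rewrite ffunE /= pmulrn gez0_abs ?modz_ge0 //.
rewrite [in LHS](divz_eq q`_i p) mulrzDr mulrC mulrzA -pmulrn.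
by rewrite (torsion_byP _ _ (lp0 _ _)) ?mul0rz ?add0r // mem_nth.
Qed.

Lemma finite_or_independent (G : zmodType) (p : nat) (X Y : zmodClosed G) :
  prime p -> {subset X <= torsion_by G p} ->
  finite_mod X Y \/ exists2 s, forall n, s n \in X & independent_mod p Y s.
Proof.
move=> p_prime Xp0.
have [[l lX Xl]|[s sP]] := exhaust_or_sequence X (fun l => sum_subg (span (nth 0 l)) Y).
  by left; apply: (finite_mod_span (prime_gt0 p_prime)) Xl => x /lX/Xp0.
right; exists s => [n|]; first by have [] := sP n.
by apply: independent_mod_prime => // n; have [/Xp0/torsion_byP] := sP n.
Qed.

Lemma finite_rank_or_independent (G : zmodType) (X : {pred G}) :
  (exists l, {subset X <= pure_closure (span (nth 0 l))}) \/
  exists2 s, forall n, s n \in X & independent_mod 0 trivial_subg s.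
Proof.
have [[l _ Xl]|[s sP]] := exhaust_or_sequence X (fun l => pure_closure (span (nth 0 l))).
  by left; exists l.
right; exists s => [n|]; first by have [] := sP n.
by apply: independent_of_not_pure_closure => n; have [] := sP n.
Qed.

Lemma int_left_kernel (r : nat) (M : 'M[int]_(r.+1, r)) :
  exists2 v : 'rV[int]_r.+1, v != 0 & v *m M = 0.
Proof.
have /rowV0Pn[u /sub_kermxP uM u_neq0] : kermx (map_mx intr M : 'M[rat]_(r.+1, r)) != 0.
  by rewrite kermx_eq0 -row_leq_rank -ltnNge ltnS rank_leq_col.
have [q [a a_neq0 uE]] := rat_poly_scale (rVpoly u).
have {}uE : map_mx intr (poly_rV q) = a%:~R *: u.
  rewrite -[u]rVpolyK uE; apply/rowP => j; rewrite !mxE coefZ coef_map mulrA.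
  by rewrite divff ?mul1r ?intr_eq0.
exists (poly_rV q).
  apply: contra_neq u_neq0 => q0; move: uE; rewrite q0 map_mx0.
  by move=> /esym/eqP; rewrite scaler_eq0 intr_eq0 (negPf a_neq0) => /eqP.
have /matrixP vM0 := map_mxM (intr : int -> rat) (poly_rV q) M.
rewrite uE -scalemxAl uM scaler0 in vM0.
apply/matrixP => i j; apply: (@intr_inj rat).
by have := vM0 i j; rewrite mxE => ->; rewrite !mxE.
Qed.

Lemma linear_dependence (G : zmodType) (l : seq G) (x : nat -> G) :
  (forall i, x i \in pure_closure (span (nth 0 l))) ->
  exists q : {poly int}, [/\ q != 0, (size q <= (size l).+1)%N & lincomb x q = 0].
Proof.
move=> x_pure.
have /choice[nc ncP] i : exists nc : nat * {poly int},
    (0 < nc.1)%N /\ x i *+ nc.1 = lincomb (nth 0 l) nc.2.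
  by have /pure_closureP[n n_gt0 /spanP[c xE]] := x_pure i; exists (n, c).
have [v v_neq0 vM] := int_left_kernel (\matrix_(i < (size l).+1, j < size l) (nc i).2`_j).
pose q := \poly_(i < (size l).+1) ((rVpoly v)`_i * (nc i).1%:Z).
have qE (i : 'I_(size l).+1) : q`_i = v 0 i * (nc i).1%:Z.
  by rewrite coef_poly ltn_ord coef_rVpoly_ord.
exists q; split; last 2 first.
- exact: size_poly.
- rewrite (lincomb_widen _ (size_poly _ _)).
  under eq_bigr => i _.
    rewrite qE mulrC mulrzA -pmulrn (ncP i).2 lincomb_nth mulrz_suml; over.
  rewrite exchange_big big1 //= => j _.
  under eq_bigr => i _ do rewrite -mulrzA.
  rewrite -mulrz_sumr.
  suff -> : \sum_(i < (size l).+1) (nc i).2`_j * v 0 i = 0 by rewrite mulr0z.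
  have /rowP/(_ j) := vM; rewrite !mxE => vMj; rewrite -[RHS]vMj.
  by apply: eq_bigr => i _; rewrite mxE mulrC.
apply: contra_neq v_neq0 => q0; apply/rowP => i; rewrite mxE.
have /eqP := qE i; rewrite q0 coef0 eq_sym mulf_eq0 => /orP[/eqP //|].
by have [] := ncP i; lia.
Qed.

(** * Shift endomorphisms *)

Section Shift.
Variables (G : zmodType) (d : nat) (s : nat -> G) (C : zmodClosed G).
Hypotheses (d_neq1 : d != 1%N) (sd0 : forall i, s i *+ d = 0).
Hypothesis s_indep : independent_mod d trivial_subg s.

Lemma shift_not_stable (f : {additive G -> G}) :
  essential_mod (span s) C -> (forall i, f (s i) = s i.+1) -> {in C, forall x, f x = 0} ->
  forall n, ~ stable_on full_subg f n.
Proof.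
move=> essC fs fC n /stable_onP/(_ (s 0%N) isT)[x _ snE].
have f_lincomb k q : iter k f (lincomb s q) = lincomb s (q * 'X^k).
  elim: k => [|k IH]; first by rewrite mulr1.
  rewrite iterS IH raddf_lincomb exprSr mulrA -['X]expr1 -lincomb_shift.
  by apply: eq_bigr => i _; rewrite /= fs addn1.
have {}snE : lincomb s 'X^n = iter n.+1 f x.
  by rewrite -snE -(lincombXn s 0) f_lincomb mul1r.
have nCx : x \notin C.
  apply/negP => /fC fx0; have := s_indep (q := 'X^n).
  rewrite snE iterSr fx0 raddf0 rpred0 => /(_ isT)/polyOverP/(_ n).
  by rewrite coefXn eqxx dvdz1 (negPf d_neq1).
have [m [c [Cc /spanP[q qE] /eqP]]] := essC x nCx; rewrite qE; case.
apply: (lincomb_eq0 sd0); apply/polyOverP => i.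
have : lincomb s ('X^n *+ m - q * 'X^(n.+1)) = 0.
  have fc0 : iter n.+1 f c = 0 by rewrite iterSr fC // raddf0.
  by rewrite raddfB raddfMn /= snE -f_lincomb -qE iter_raddfB fc0 subr0 -raddfMn subrr.
move/trivial_subgP/s_indep/polyOverP/(_ (i + n.+1)%N).
rewrite coefB coefMn coefXn coefMXn addnK gtn_eqF ?ltn_addl // mul0rn sub0r.
by rewrite ltnNge leq_addl /= rpredN.
Qed.

Definition shift_graph : {pred G * G} :=
  fun z => `[< exists2 q, z.1 - lincomb s q \in C & z.2 = lincomb s (q * 'X) >].

Lemma shift_graphP x y :
  reflect (exists2 q, x - lincomb s q \in C & y = lincomb s (q * 'X))
    ((x, y) \in shift_graph).
Proof. exact: asboolP. Qed.

Fact shift_graph_closed : zmod_closed shift_graph.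
Proof.
split=> [|[x y] [x' y'] /shift_graphP[q Cxq ->] /shift_graphP[q' Cxq' ->]];
  apply/shift_graphP.
  by exists 0; rewrite ?mul0r raddf0 // subrr rpred0.
exists (q - q'); last by rewrite mulrBl raddfB.
by rewrite raddfB opprD addrACA -opprD rpredB.
Qed.

HB.instance Definition _ := GRing.isZmodClosed.Build _ shift_graph shift_graph_closed.

Lemma shift_graph_functional y :
  meets_trivially C (span s) -> (0, y) \in shift_graph -> y = 0.
Proof.
move=> Cs /shift_graphP[q]; rewrite sub0r rpredN => Cq ->.
rewrite -['X]expr1 -lincomb_shift; apply: (lincomb_eq0 (d := d)) => //.
by apply/s_indep/trivial_subgP/Cs => //; apply: mem_span.
Qed.

Lemma shift_graph_range x y (E : zmodClosed G) :
  (forall i, s i \in E) -> (x, y) \in shift_graph -> y \in E.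
Proof. by move=> Es /shift_graphP[q _ ->]; apply: (span_sub Es) (mem_span _ _). Qed.

Lemma shift_graph_not_extendable :
  strongly_coHopfian G -> essential_mod (span s) C ->
  ~ exists f : {additive G -> G}, forall x y, (x, y) \in shift_graph -> f x = y.
Proof.
move=> /strongly_coHopfianP coHopf essC [f fP]; have [n] := coHopf f.
apply: shift_not_stable => // [i|x Cx]; apply/fP/shift_graphP.
  by exists 'X^i; rewrite -?exprSr lincombXn ?subrr ?rpred0.
by exists 0; rewrite ?mul0r raddf0 /= ?subr0.
Qed.

End Shift.

Section NoIndependentSequences.
Variable G : zmodType.
Hypothesis coHopf : strongly_coHopfian G.

Lemma divisible_no_independent (E : zmodClosed G) (d : nat) (s : nat -> G) :
  divisible E -> d != 1%N -> (forall i, s i *+ d = 0) -> (forall i, s i \in E) ->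
  ~ independent_mod d trivial_subg s.
Proof.
move=> divE d_neq1 sd0 Es s_indep.
have [|C [_ Cs essC]] := @exists_essential_complement _ (span s) trivial_subg.
  by move=> x /trivial_subgP.
apply: (shift_graph_not_extendable d_neq1 sd0 s_indep coHopf essC).
have [y|x y|f [fP _]] := @divisible_extension G G E (shift_graph s C) divE.
- exact: (shift_graph_functional sd0 s_indep Cs).
- exact: shift_graph_range.
- by exists f.
Qed.

Lemma multiples_of_torsion_by (p k : nat) (s : nat -> G) x :
  prime p -> independent_mod (p ^ k.+1) trivial_subg s ->
  x \in span s -> x *+ p ^ k = 0 -> x \in multiples p (span s).
Proof.
move=> p_prime s_indep /spanP[q ->] qpk0.
have /polyOver_dvdzP[q' ->] : q \is a polyOver (dvdz p).
  have /trivial_subgP/s_indep/polyOverP dvd_q : lincomb s (q *+ p ^ k) = 0.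
    by rewrite raddfMn.
  apply/polyOverP => i; have := dvd_q i.
  by rewrite coefMn expnS -mulr_natr PoszM natz dvdz_mul2r // -lt0n expn_gt0 prime_gt0.
by rewrite lincombZ -pmulrn; apply/mem_multiples/mem_span.
Qed.

(* Such a sequence spans a pure subgroup of bounded exponent, hence a direct summand. *)
Lemma homogeneous_not_independent (p k : nat) (s : nat -> G) :
  prime p -> (forall i, s i *+ p ^ k.+1 = 0) ->
  ~ independent_mod (p ^ k.+1) (multiples (p ^ k.+1) full_subg) s.
Proof.
move=> p_prime s_pk0 s_indep.
have [|C [KC Cs essC]] :=
  @exists_essential_complement _ (span s) (multiples (p ^ k.+1) full_subg).
  by move=> x Kx /spanP[q xE]; rewrite xE in Kx *; apply/lincomb_eq0/s_indep.
have {}s_indep : independent_mod (p ^ k.+1) trivial_subg s.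
  by move=> q /trivial_subgP q0; apply: s_indep; rewrite q0 rpred0.
have pk_neq1 : (p ^ k.+1 != 1)%N.
  by rewrite gtn_eqF // -(exp1n k.+1) ltn_exp2r // prime_gt1.
apply: (shift_graph_not_extendable pk_neq1 s_pk0 s_indep coHopf essC).
have s_full : forall x, x \in sum_subg (span s) C.
  apply: essential_complement => // r x b c r_prime sb Cc xrE.
  have [rE|r_neq_p] := eqVneq r p; last first.
    apply: (mem_multiples_coprime (n := p ^ k.+1) _ sb).
      by rewrite coprimeXr // prime_coprime // dvdn_prime2.
    suff /torsion_byP-> : b \in torsion_by G (p ^ k.+1) by rewrite rpred0.
    by apply: (span_sub _ sb) => i; apply/torsion_byP.
  have bpk0 : b *+ p ^ k = 0.
    apply: Cs; last by rewrite rpredMn.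
    rewrite -[b](addrK c) -xrE rE mulrnBl -mulrnA -expnS.
    by rewrite rpredB //; [apply/KC/mem_multiples|apply: rpredMn].
  by rewrite rE; apply: (multiples_of_torsion_by p_prime s_indep).
have [x|y|f fP] := @additive_of_graph G G (shift_graph s C); last by exists f.
- have /sum_subgP[_ /spanP[q ->] Cxq] := s_full x.
  by exists (lincomb s (q * 'X)); apply/shift_graphP; exists q.
- exact: (shift_graph_functional s_pk0 s_indep Cs).
Qed.

End NoIndependentSequences.

(** * Structure of strongly co-Hopfian groups *)

Section CanonicalSubgroups.
Variable G : zmodType.

Definition primary (n : nat) : {pred G} := fun x => `[< exists k, x *+ n ^ k = 0 >].

(* The subgroup usually written [n^omega G]. *)
Definition omega_part (n : nat) : {pred G} :=
  fun x => `[< forall k, x \in multiples (n ^ k) full_subg >].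

Definition divisible_part : {pred G} :=
  fun x => `[< forall p : nat, prime p -> x \in omega_part p >].

Definition torsion_part : {pred G} := pure_closure trivial_subg.
HB.instance Definition _ := GRing.ZmodClosed.on torsion_part.

Lemma primaryP n x : reflect (exists k, x *+ n ^ k = 0) (x \in primary n).
Proof. exact: asboolP. Qed.

Lemma omega_partP n x :
  reflect (forall k, x \in multiples (n ^ k) full_subg) (x \in omega_part n).
Proof. exact: asboolP. Qed.

Lemma divisible_partP x :
  reflect (forall p : nat, prime p -> x \in omega_part p) (x \in divisible_part).
Proof. exact: asboolP. Qed.

Lemma torsion_partP x : reflect (torsion x) (x \in torsion_part).
Proof.
apply: (iffP (pure_closureP _ _)) => -[n n_gt0 xn0]; exists n => //.
  exact/trivial_subgP.
exact/trivial_subgP.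
Qed.

Fact primary_closed n : zmod_closed (primary n).
Proof.
split=> [|x y /primaryP[j xj0] /primaryP[k yk0]]; apply/primaryP.
  by exists 0%N; rewrite mul0rn.
by exists (j + k)%N; rewrite expnD mulrnBl mulrnA xj0 mulnC mulrnA yk0 !mul0rn subrr.
Qed.

HB.instance Definition _ n := GRing.isZmodClosed.Build G (primary n) (primary_closed n).

Fact omega_part_closed n : zmod_closed (omega_part n).
Proof.
split=> [|x y /omega_partP wx /omega_partP wy]; apply/omega_partP => k.
  exact: rpred0.
by rewrite rpredB ?wx ?wy.
Qed.

HB.instance Definition _ n :=
  GRing.isZmodClosed.Build G (omega_part n) (omega_part_closed n).

Fact divisible_part_closed : zmod_closed divisible_part.
Proof.
split=> [|x y /divisible_partP Dx /divisible_partP Dy];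
  apply/divisible_partP => p p_prime.
  exact: rpred0.
by rewrite rpredB ?Dx ?Dy.
Qed.

HB.instance Definition _ :=
  GRing.isZmodClosed.Build G divisible_part divisible_part_closed.

Definition primary_omega (n : nat) : {pred G} := cap_subg (primary n) (omega_part n).
HB.instance Definition _ n := GRing.ZmodClosed.on (primary_omega n).

Lemma primary_omegaP n x :
  reflect (x \in primary n /\ x \in omega_part n) (x \in primary_omega n).
Proof. exact: cap_subgP. Qed.

Lemma primary_torsion n : (0 < n)%N -> {subset primary n <= torsion_part}.
Proof.
move=> n_gt0 x /primaryP[k xk0]; apply/torsion_partP.
by exists (n ^ k)%N; rewrite // expn_gt0 n_gt0.
Qed.

Lemma torsion_part_generated (S : zmodClosed G) :
  (forall p : nat, prime p -> {subset primary p <= S}) -> {subset torsion_part <= S}.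
Proof.
move=> primaryS x /torsion_partP[n]; elim/ltn_ind: n x => n IH x n_gt0 xn0.
have [n_le1|n_gt1] := leqP n 1.
  by move: xn0; rewrite (_ : n = 1%N) ?mulr1n => [->|]; [apply: rpred0|lia].
have p_prime := pdiv_prime n_gt1.
have [m pm_coprime nE] := pfactor_coprime p_prime n_gt0.
set p := pdiv n in p_prime pm_coprime nE; set k := logn p n in nE.
have k_gt0 : (0 < k)%N by rewrite logn_gt0 mem_primes p_prime n_gt0 pdiv_dvd.
apply: (@mem_coprime _ S (p ^ k) m); first by rewrite coprimeXl.
  have m_gt0 : (0 < m)%N by move: n_gt0; rewrite nE muln_gt0 => /andP[].
  apply: (IH m) => //; last by rewrite -mulrnA mulnC -nE.
  by rewrite nE ltn_Pmulr // -(exp1n k) ltn_exp2r // prime_gt1.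
by apply: (primaryS p p_prime); apply/primaryP; exists k; rewrite -mulrnA -nE.
Qed.

Lemma primary_in_omega_part p q : prime p -> prime q -> p != q ->
  {subset primary q <= omega_part p}.
Proof.
move=> p_prime q_prime p_neq_q x /primaryP[j xj0]; apply/omega_partP => k.
apply: (mem_multiples_coprime (n := q ^ j)) => //; last by rewrite xj0 rpred0.
by rewrite coprimeXl // coprimeXr // prime_coprime // dvdn_prime2.
Qed.

Lemma primary_omega_divisible_part p : prime p ->
  {subset primary_omega p <= divisible_part}.
Proof.
move=> p_prime x /primary_omegaP[px wx]; apply/divisible_partP => q q_prime.
by have [-> //|q_neq_p] := eqVneq q p; apply: primary_in_omega_part px.
Qed.

Variable f : {additive G -> G}.

Lemma primary_invariant n : invariant_under (primary n) f.
Proof.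
move=> x /primaryP[k xk0]; apply/primaryP; exists k.
by rewrite -raddfMn xk0 raddf0.
Qed.

Lemma omega_part_invariant n : invariant_under (omega_part n) f.
Proof.
move=> x /omega_partP wx; apply/omega_partP => k; have /multiplesP[y _ ->] := wx k.
by rewrite raddfMn; apply: mem_multiples.
Qed.

Lemma divisible_part_invariant : invariant_under divisible_part f.
Proof.
move=> x /divisible_partP Dx; apply/divisible_partP => p p_prime.
by apply: omega_part_invariant; apply: Dx.
Qed.

Lemma primary_omega_invariant n : invariant_under (primary_omega n) f.
Proof.
move=> x /primary_omegaP[px wx]; apply/primary_omegaP.
by split; [apply: primary_invariant|apply: omega_part_invariant].
Qed.

Lemma torsion_part_invariant : invariant_under torsion_part f.
Proof.
move=> x /torsion_partP[n n_gt0 xn0]; apply/torsion_partP; exists n => //.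
by rewrite -raddfMn xn0 raddf0.
Qed.

End CanonicalSubgroups.
Arguments primary G n : clear implicits.
Arguments omega_part G n : clear implicits.
Arguments primary_omega G n : clear implicits.
Arguments divisible_part G : clear implicits.
Arguments torsion_part G : clear implicits.

Section Decomposition.
Variable G : zmodType.
Hypothesis coHopf : strongly_coHopfian G.

Lemma multiples_sub_omega_part n :
  exists k, {subset multiples (n ^ k) full_subg <= omega_part G n}.
Proof.
have iterE k (x : G) : iter k (mulrn_endo n) x = x *+ n ^ k.
  by elim: k => // k IH; rewrite iterS IH expnSr mulrnA.
have [k stable] := proj1 (strongly_coHopfianP G) coHopf (mulrn_endo n).
exists k => _ /multiplesP[x _ ->]; apply/omega_partP => j.
have stable_j := stable_mod_iter (trivial_invariant _) stable j.
have [y _ /trivial_subgP/subr0_eq] := stable_j x isT.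
by rewrite !iterE => ->; rewrite expnD mulrnA; apply: mem_multiples.
Qed.

Lemma omega_part_multiples n :
  {subset omega_part G n <= multiples n (omega_part G n)}.
Proof.
have [k nk_omega] := multiples_sub_omega_part n.
move=> x /omega_partP/(_ k.+1)/multiplesP[y _ ->]; apply/multiplesP.
by exists (y *+ n ^ k); [apply/nk_omega/mem_multiples|rewrite -mulrnA expnSr].
Qed.

Lemma torsion_by_omega_part_sum n :
  exists k, forall x : G, x \in sum_subg (torsion_by G (n ^ k)) (omega_part G n).
Proof.
have [k nk_omega] := multiples_sub_omega_part n; exists k => x.
have /nk_omega/omega_partP/(_ (k + k)%N)/multiplesP[y _ xE] :
  x *+ n ^ k \in multiples (n ^ k) full_subg by apply: mem_multiples.
apply/sum_subgP; exists (x - y *+ n ^ k); last by rewrite subKr nk_omega // mem_multiples.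
by apply/torsion_byP; rewrite mulrnBl xE expnD mulrnA subrr.
Qed.

Lemma divisible_part_divisible : divisible (divisible_part G).
Proof.
move=> p p_prime x /divisible_partP Dx.
have /multiplesP[y wy xE] := omega_part_multiples (Dx p p_prime).
apply/multiplesP; exists y => //; apply/divisible_partP => q q_prime.
have [->//|q_neq_p] := eqVneq q p; apply/omega_partP => k.
apply: (mem_multiples_coprime (n := p)) => //; last first.
  by rewrite -xE (omega_partP _ _ (Dx q q_prime)).
by rewrite coprimeXl // prime_coprime // dvdn_prime2.
Qed.

Lemma primary_omega_divisible n : divisible (primary_omega G n).
Proof.
move=> q q_prime x Dx; have /primary_omegaP[/primaryP[k xk0] wx] := Dx.
have [/dvdnP[m nE]|q_ndvd_n] := boolP (q %| n)%N; last first.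
  apply: (mem_multiples_coprime (n := n ^ k)) => //; last by rewrite xk0 rpred0.
  by rewrite coprimeXr // prime_coprime.
have /multiplesP[y wy xE] := omega_part_multiples wx.
apply/multiplesP; exists (y *+ m); last by rewrite -mulrnA -nE.
rewrite rpredMn //; apply/primary_omegaP; split=> //; apply/primaryP.
by exists k.+1; rewrite expnS mulrnA -xE.
Qed.

Lemma exists_primary_projection n : exists pi : {additive G -> G},
  (forall x, pi x \in primary G n) /\ {in primary G n, forall x, pi x = x}.
Proof.
pose D : {pred G * G} :=
  cap_subg (preim_subg fst (primary_omega G n)) (preim_subg (fst \- snd) trivial_subg).
have DP x y : reflect (x \in primary_omega G n /\ x = y) ((x, y) \in D).
  apply: (iffP (cap_subgP _ _ _)) => -[Dx xyE]; split=> //.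
    exact/subr0_eq/trivial_subgP.
  by apply/trivial_subgP; rewrite /= xyE subrr.
have [y|x y|f [fP f_range]] :=
  @divisible_extension G G _ D (@primary_omega_divisible n).
- by case/DP.
- by case/DP=> Dx <-.
pose C := cap_subg (omega_part G n) (preim_subg f trivial_subg).
have CP x : reflect (x \in omega_part G n /\ f x = 0) (x \in C).
  by apply: (iffP (cap_subgP _ _ _)) => -[wx /trivial_subgP].
have f_id x : x \in primary_omega G n -> f x = x by move=> Dx; apply/fP/DP.
apply: (@projection_of_complement _ (primary G n) C) => [x px /CP[wx <-]|x].
  by rewrite f_id //; apply/primary_omegaP.
have [k /(_ x)/sum_subgP[t /torsion_byP tk0 wxt]] := torsion_by_omega_part_sum n.
have /primary_omegaP[pfx wfx] := f_range (x - t).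
apply/sum_subgP; exists (t + f (x - t)).
  by rewrite rpredD //; apply/primaryP; exists k.
apply/CP; rewrite opprD addrA rpredB //; split=> //.
by rewrite [LHS]raddfB /= (f_id (f (x - t))) ?subrr.
Qed.

Lemma exists_primary_projections : exists pi : nat -> {additive G -> G},
  (forall n x, pi n x \in primary G n) /\
  forall n, {in primary G n, forall x, pi n x = x}.
Proof.
by have [pi piP] := choice exists_primary_projection; exists pi; split=> n; case: (piP n).
Qed.

End Decomposition.

(** * Finiteness *)

Lemma independent_mod_divide (G : zmodType) (p k : nat) (g s : nat -> G) :
  prime p -> (forall i, s i = g i *+ p ^ k) ->
  independent_mod p (multiples (p ^ k.+1) full_subg) s ->
  independent_mod (p ^ k.+1) (multiples (p ^ k.+1) full_subg) g.
Proof.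
move=> p_prime sE s_indep q Yq.
have lincomb_sE r : lincomb s r = lincomb g r *+ p ^ k.
  by rewrite -sumrMnl; apply: eq_bigr => i _; rewrite sE !pmulrn mulrzAC.
suff dvd_q j : (j <= k.+1)%N -> q \is a polyOver (dvdz (p ^ j)%N) by apply: dvd_q.
elim: j => [_|j IH j_le]; first by apply/polyOverP => i; rewrite expn0 dvd1z.
have /polyOver_dvdzP[r qE] := IH (ltnW j_le).
have /s_indep/polyOver_dvdzP[r' rE] : lincomb s r \in multiples (p ^ k.+1) full_subg.
  have -> : lincomb s r = lincomb g r *+ p ^ j *+ p ^ (k - j).
    by rewrite lincomb_sE -mulrnA -expnD subnKC.
  by rewrite qE lincombZ -pmulrn in Yq; apply: rpredMn.
by apply/polyOver_dvdzP; exists r'; rewrite qE rE scalerA -PoszM -expnSr.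
Qed.

Lemma finite_torsion_byM (G : zmodType) (a b : nat) :
  finite_mod (torsion_by G a) trivial_subg -> finite_mod (torsion_by G b) trivial_subg ->
  finite_mod (torsion_by G (a * b)) trivial_subg.
Proof.
move=> /finite_mod_trivialP[L aL] /finite_mod_trivialP[L' bL'].
apply/finite_mod_trivialP.
have /choice[g gP] : forall y : G, exists g, (exists x, x *+ a = y) -> g *+ a = y.
  move=> y; have [[x xE]|no_x] := pselect (exists x, x *+ a = y); first by exists x.
  by exists 0.
exists [seq g y + z | y <- L', z <- L] => x /torsion_byP.
rewrite mulrnA => /torsion_byP/bL' L'x.
rewrite -[x](subrK (g (x *+ a))) addrC; apply: allpairs_f => //.
by apply/aL/torsion_byP; rewrite mulrnBl gP ?subrr //; exists x.
Qed.

Section Finiteness.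
Variable G : zmodType.
Hypothesis coHopf : strongly_coHopfian G.

Lemma divisible_part_finite_rank :
  exists l : seq G, {subset divisible_part G <= pure_closure (span (nth 0 l))}.
Proof.
have [//|[s Ds s_indep]] := finite_rank_or_independent (divisible_part G).
have divG := divisible_part_divisible coHopf.
by case: (divisible_no_independent coHopf divG _ _ Ds s_indep).
Qed.

Lemma divisible_socle_finite p : prime p ->
  finite_mod (cap_subg (torsion_by G p) (divisible_part G)) trivial_subg.
Proof.
move=> p_prime.
have [x /cap_subgP[]|//|[s Xs s_indep]] :=
  @finite_or_independent _ p (cap_subg (torsion_by G p) (divisible_part G))
    trivial_subg p_prime; first by [].
exfalso; have divG := divisible_part_divisible coHopf.
apply: (divisible_no_independent coHopf divG) s_indep => [|i|i].
- by rewrite gtn_eqF ?prime_gt1.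
- by have /cap_subgP[/torsion_byP] := Xs i.
- by have /cap_subgP[] := Xs i.
Qed.

Lemma socle_layer_finite p k : prime p ->
  finite_mod (cap_subg (torsion_by G p) (multiples (p ^ k) full_subg))
    (multiples (p ^ k.+1) full_subg).
Proof.
move=> p_prime.
have [x /cap_subgP[]|//|[s Xs s_indep]] :=
  @finite_or_independent _ p (cap_subg (torsion_by G p) (multiples (p ^ k) full_subg))
    (multiples (p ^ k.+1) full_subg) p_prime; first by [].
have /choice[g sE] i : exists g, s i = g *+ p ^ k.
  by have /cap_subgP[_ /multiplesP[g _ sE]] := Xs i; exists g.
exfalso; apply: (homogeneous_not_independent (k := k) (s := g) coHopf p_prime) => [i|].
  by rewrite expnSr mulrnA -sE; have /cap_subgP[/torsion_byP] := Xs i.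
exact: independent_mod_divide sE s_indep.
Qed.

Lemma socle_finite p : prime p -> finite_mod (torsion_by G p) trivial_subg.
Proof.
move=> p_prime.
have finite_mod_multiples k : finite_mod (torsion_by G p) (multiples (p ^ k) full_subg).
  elim: k => [|k IH]; last exact: finite_mod_trans IH (socle_layer_finite k p_prime).
  exists [:: 0] => x _; exists 0; first exact: mem_head.
  by rewrite subr0; apply/multiplesP; exists x.
have [k pk_omega] := multiples_sub_omega_part coHopf p.
apply: finite_mod_trans (finite_mod_multiples k) _.
have [L LP] := divisible_socle_finite p_prime.
exists L => x /cap_subgP[xp /pk_omega wx]; apply/LP/cap_subgP; split=> //.
apply: (primary_omega_divisible_part p_prime); apply/primary_omegaP; split=> //.
by apply/primaryP; exists 1%N; apply/torsion_byP.
Qed.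

Lemma torsion_by_pow_finite p k :
  prime p -> finite_mod (torsion_by G (p ^ k)) trivial_subg.
Proof.
move=> p_prime; elim: k => [|k IH].
  exists [:: 0] => x /torsion_byP; rewrite mulr1n => ->.
  by exists 0; rewrite ?inE ?subrr ?rpred0.
by rewrite expnS; apply: finite_torsion_byM => //; apply: socle_finite.
Qed.

Lemma full_mod_omega_part_finite p : prime p -> finite_mod full_subg (omega_part G p).
Proof.
move=> p_prime; have [k Gsum] := torsion_by_omega_part_sum coHopf p.
exact: finite_mod_sum_subg (in1W Gsum) (torsion_by_pow_finite k p_prime).
Qed.

Lemma primary_mod_omega_finite p : prime p ->
  finite_mod (primary G p) (primary_omega G p).
Proof.
move=> p_prime; have [k Gsum] := torsion_by_omega_part_sum coHopf p.
apply: finite_mod_sum_subg (torsion_by_pow_finite k p_prime) => x px.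
have /sum_subgP[t tk wxt] := Gsum x; apply/sum_subgP; exists t => //.
apply/primary_omegaP; split; rewrite // rpredB //.
by apply/primaryP; exists k; apply/torsion_byP.
Qed.

End Finiteness.

(** * Bounds on the index of stabilisation *)

Lemma sub_of_divisible_socle (G : zmodType) (p : nat) (A B : zmodClosed G) :
  {subset A <= primary G p} -> {subset B <= A} -> {subset B <= multiples p B} ->
  {subset cap_subg A (torsion_by G p) <= B} -> {subset A <= B}.
Proof.
move=> A_primary BA divB socleB x Ax; have /primaryP[k] := A_primary x Ax.
elim: k x Ax => [|k IH] x Ax; first by rewrite mulr1n => ->; apply: rpred0.
rewrite expnS mulrnA => /IH; rewrite rpredMn // => /(_ isT)/divB/multiplesP[y By xpE].
rewrite -[x](subrK y) rpredD //; apply/socleB/cap_subgP; split.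
  by rewrite rpredB // BA.
by apply/torsion_byP; rewrite mulrnBl xpE subrr.
Qed.

Lemma image_iter_sub (G : zmodType) (A : {pred G}) (f : G -> G) i j :
  invariant_under A f -> (i <= j)%N ->
  {subset image_subg (iter j f) A <= image_subg (iter i f) A}.
Proof.
move=> fA i_le_j _ /image_subgP[x Ax ->]; apply/image_subgP.
by exists (iter (j - i) f x); rewrite ?iter_invariant // -iterD subnKC.
Qed.

Lemma image_multiples (G H : zmodType) (f : {additive G -> H}) n (A : {pred G}) :
  {subset A <= multiples n A} -> {subset image_subg f A <= multiples n (image_subg f A)}.
Proof.
move=> divA _ /image_subgP[x /divA/multiplesP[y Ay ->] ->].
by apply/multiplesP; exists (f y); [apply: mem_image_subg|apply: raddfMn].
Qed.

Lemma finite_socle_stable (G : zmodType) (p : nat) (A : zmodClosed G) :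
  {subset A <= primary G p} -> {subset A <= multiples p A} ->
  finite_mod (cap_subg A (torsion_by G p)) trivial_subg ->
  exists n, forall f : {additive G -> G}, invariant_under A f -> stable_on A f n.
Proof.
move=> A_primary divA /finite_mod_pigeonhole[n pigeonhole]; exists n => f fA.
pose I j := image_subg (iter j f) A.
have IA j : {subset I j <= A} by move=> _ /image_subgP[x Ax ->]; apply: iter_invariant.
apply: contrapT => unstable.
have /choice[x xP] j : exists x, x \in cap_subg A (torsion_by G p) /\
    ((j <= n)%N -> x \in I j /\ x \notin I j.+1).
  have [j_le|_] := leqP j n; last by exists 0; rewrite rpred0.
  apply: contrapT => no_x; apply: unstable.
  apply: (stable_mod_leq (trivial_invariant f) j_le); apply/stable_onP => x Ax.
  apply/image_subgP/(@sub_of_divisible_socle _ p (I j)); last exact: mem_image_subg.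
  - by move=> y /IA/A_primary.
  - exact: image_iter_sub.
  - exact: image_multiples.
  - move=> y /cap_subgP[Iy yp]; apply: contrapT => /negP nIy; apply: no_x; exists y.
    by split=> //; apply/cap_subgP; split=> //; apply: IA Iy.
have [|i [j [i_lt_j j_le /trivial_subgP/subr0_eq xij]]] := pigeonhole x.
  by move=> i; case: (xP i).
have [_ /(_ (leq_trans (ltnW i_lt_j) j_le))[_ /negP]] := xP i; apply.
by rewrite xij; apply: image_iter_sub i_lt_j _ _ => //; have [_ /(_ j_le)[]] := xP j.
Qed.

Lemma finite_rank_stable_mod_torsion (G : zmodType)
    (A : zmodClosed G) (l : seq G) (f : {additive G -> G}) :
  divisible A -> invariant_under A f -> {subset A <= pure_closure (span (nth 0 l))} ->
  stable_mod A (torsion_part G) f (size l).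
Proof.
move=> divA fA A_rank.
apply: contrapT => /(unstable_sequence (torsion_part_invariant f))[x xP].
pose u j := iter j f (x j).
have [|q [q_neq0 q_le q0]] := @linear_dependence _ l u.
  by move=> i; apply/A_rank/iter_invariant => //; case: (xP i).
have ex_j : exists j, q`_j != 0 by exists (size q).-1; rewrite -lead_coefE lead_coef_eq0.
case: (ex_minnP ex_j) => j qj_neq0 j_min.
have j_le : (j <= size l)%N.
  rewrite -ltnS (leq_trans _ q_le) // ltnNge.
  by apply: contra qj_neq0 => /(nth_default 0)->.
have /image_subgP[a Aa tailE] :
    lincomb (fun i => u (i + j.+1)%N) (drop_poly j.+1 q) \in image_subg (iter j.+1 f) A.
  apply: (span_sub _ (mem_span _ _)) => i.
  by rewrite /u addnC iterD mem_image_subg // iter_invariant //; case: (xP (j.+1 + i)%N).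
have [b Ab aE] := divisible_mulrz divA qj_neq0 Aa.
have [_ /(_ j_le (- b))] := xP j; rewrite rpredN => /(_ Ab)/negP; apply.
apply/(pure_closureMz qj_neq0)/sub_pure_closure/trivial_subgP.
have -> : iter j.+1 f (- b) = - iter j.+1 f b by rewrite raddfN.
have fbE : iter j.+1 f b *~ q`_j = iter j.+1 f a by rewrite aE raddfMz.
rewrite opprK mulrzDl fbE -tailE -lincomb_lowest // => i i_lt_j.
by apply/eqP; apply: contraTT i_lt_j => /j_min; rewrite -leqNgt.
Qed.

Section Bounds.
Variable G : zmodType.
Hypothesis coHopf : strongly_coHopfian G.

Lemma primary_omega_stable p : prime p -> exists n, forall f : {additive G -> G},
  stable_on (primary_omega G p) f n.
Proof.
move=> p_prime; have [|||n stable] := @finite_socle_stable G p (primary_omega G p).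
- by move=> x /primary_omegaP[].
- exact: primary_omega_divisible.
- have /finite_mod_trivialP[L pL] := socle_finite coHopf p_prime.
  by apply/finite_mod_trivialP; exists L => x /cap_subgP[_ /pL].
by exists n => f; apply/stable/primary_omega_invariant.
Qed.

Lemma primary_stable p : prime p -> exists n, forall f : {additive G -> G},
  stable_on (primary G p) f n.
Proof.
move=> p_prime.
have [m stable_top] := finite_mod_stable (primary_mod_omega_finite coHopf p_prime).
have [n stable_bottom] := primary_omega_stable p_prime; exists (m + n)%N => f.
apply: stable_mod_trans (stable_top f _ _) (stable_bottom f).
- by move=> x /primary_omegaP[].
- exact: trivial_invariant.
- exact: primary_invariant.
- exact: primary_omega_invariant.
Qed.

Lemma full_mod_divisible_part_stable (f : {additive G -> G}) N :
  (forall p : nat, prime p -> stable_on (primary G p) f N) ->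
  stable_mod full_subg (divisible_part G) f N.
Proof.
move=> stable x _.
have [n /stable_onP/(_ x isT)[z _ xzE]] := proj1 (strongly_coHopfianP G) coHopf f.
exists z => //; apply/divisible_partP => p p_prime.
rewrite iterSr -iter_raddfB.
have G_finite := full_mod_omega_part_finite coHopf p_prime.
apply: (finite_mod_kernel_stable G_finite (n := n)) => //.
- exact: omega_part_invariant.
- move=> y _; have [k /(_ y)/sum_subgP[t tk wyt]] := torsion_by_omega_part_sum coHopf p.
  have pt : t \in primary G p by apply/primaryP; exists k; apply/torsion_byP.
  have [t' _ tE] := proj1 (stable_onP _ _ _) (stable p p_prime) t pt.
  exists t' => //; rewrite -tE -iter_raddfB; apply: iter_invariant wyt.
  exact: omega_part_invariant.
- by rewrite iter_raddfB xzE iterSr subrr rpred0.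
Qed.

End Bounds.

(** * Endomorphisms of the torsion subgroup *)

Section Gluing.
Variables (G : zmodType) (pi : nat -> {additive G -> G}).
Hypothesis pi_primary : forall n x, pi n x \in primary G n.
Hypothesis pi_id : forall n, {in primary G n, forall x, pi n x = x}.

Lemma projection_coprime_eq0 m n x : coprime m n -> x \in primary G n -> pi m x = 0.
Proof.
move=> mn_coprime nx; have /primaryP[j mj0] := pi_primary m x.
have /primaryP[k nk0] := primary_invariant (pi m) nx.
apply/trivial_subgP/(@mem_coprime _ trivial_subg (m ^ j) (n ^ k)).
- by rewrite coprimeXl // coprimeXr.
- exact/trivial_subgP.
- exact/trivial_subgP.
Qed.

Lemma torsion_projections_eq0 x :
  torsion x -> (forall p : nat, prime p -> pi p x = 0) -> x = 0.
Proof.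
move=> [n n_gt0]; elim/prime_mul_ind: n_gt0 x => [|p m p_prime _ IH] x.
  by rewrite mulr1n.
rewrite mulrnA => xpm0 pix0.
have xp0 : x *+ p = 0 by apply: IH => // q q_prime; rewrite raddfMn pix0 ?mul0rn.
by rewrite -(@pi_id p x) ?pix0 //; apply/primaryP; exists 1%N.
Qed.

Variable F : nat -> {additive G -> G}.

Definition glue_graph : {pred G * G} := fun z =>
  (z.2 \in torsion_part G) && `[< forall p : nat, prime p -> pi p z.2 = F p (pi p z.1) >].

Lemma glue_graphP x z :
  reflect (z \in torsion_part G /\ forall p : nat, prime p -> pi p z = F p (pi p x))
    ((x, z) \in glue_graph).
Proof. by apply: (iffP andP) => -[tz /asboolP]. Qed.

Fact glue_graph_closed : zmod_closed glue_graph.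
Proof.
split=> [|[x z] [y w] /glue_graphP[tz zE] /glue_graphP[tw wE]]; apply/glue_graphP.
  by split=> [|p _]; rewrite ?rpred0 ?raddf0.
by split=> [|p p_prime]; rewrite ?rpredB // !raddfB zE // wE.
Qed.

HB.instance Definition _ := GRing.isZmodClosed.Build _ glue_graph glue_graph_closed.

Lemma glue_graph_functional z : (0, z) \in glue_graph -> z = 0.
Proof.
case/glue_graphP=> /torsion_partP tz zE; apply: torsion_projections_eq0 => // p p_prime.
by rewrite zE // !raddf0.
Qed.

Lemma glue_graph_total : {in torsion_part G, forall x, exists z, (x, z) \in glue_graph}.
Proof.
move=> x tx; suff /image_subgP[[y z] yz ->] : x \in image_subg fst glue_graph by exists z.
apply: torsion_part_generated tx => q q_prime y qy.
have qFy := primary_invariant (F q) qy.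
apply/image_subgP; exists (y, F q y) => //; apply/glue_graphP.
split=> [|p p_prime]; first exact: primary_torsion (prime_gt0 q_prime) _ qFy.
have [->|p_neq_q] := eqVneq p q; first by rewrite !pi_id.
by rewrite !(@projection_coprime_eq0 p q) ?raddf0 // prime_coprime // dvdn_prime2.
Qed.

Lemma exists_torsion_glue : exists2 f, endo_on (@torsion G) f &
  forall (p : nat) x, prime p -> torsion x -> pi p (f x) = F p (pi p x).
Proof.
have /choice[f fP] x : exists z, x \in torsion_part G -> (x, z) \in glue_graph.
  have [/glue_graph_total[z xz]|_] := boolP (x \in torsion_part G); first by exists z.
  by exists 0.
exists f => [|p x p_prime /torsion_partP/fP/glue_graphP[_ ->] //].
split=> [x /torsion_partP/fP/glue_graphP[/torsion_partP]//|x y].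
move=> /torsion_partP tx /torsion_partP ty.
apply/subr0_eq/glue_graph_functional; rewrite opprD addrA.
have -> : (0, f (x + y) - f x - f y) = (x + y, f (x + y)) - (x, f x) - (y, f y).
  by congr pair; rewrite /= [x + y]addrC !addrK ?subrr.
by rewrite !rpredB ?fP ?rpredD.
Qed.

End Gluing.

Lemma exists_extremal_endomorphism (G : zmodType) (S : zmodClosed G) :
  (exists n, forall f : {additive G -> G}, stable_on S f n) ->
  exists F : {additive G -> G}, forall n, stable_on S F n ->
    forall f : {additive G -> G}, stable_on S f n.
Proof.
pose bound n := `[< forall f : {additive G -> G}, stable_on S f n >].
move=> [n0 n0P]; have ex_bound : exists n, bound n by exists n0; apply/asboolP.
case: (ex_minnP ex_bound) => -[|n] /asboolP nP n_min.
  exists idfun => n _ f; exact: stable_mod_leq (trivial_invariant f) (leq0n n) (nP f).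
have /existsNP[F unstable] :
    ~ forall f : {additive G -> G}, stable_on S f n.
  by move=> /asboolP/n_min; rewrite ltnn.
exists F => m stable f; apply: stable_mod_leq (trivial_invariant f) _ (nP f).
rewrite ltnNge; apply/negP => m_le.
by apply: unstable; apply: stable_mod_leq (trivial_invariant F) m_le stable.
Qed.

Lemma torsion_stable (G : zmodType) (f : {additive G -> G}) N :
  (forall p : nat, prime p -> stable_on (primary G p) f N) ->
  stable_on (torsion_part G) f N.
Proof.
move=> stable; apply/stable_onP => x tx.
pose S := preim_subg (iter N f) (image_subg (iter N.+1 f) (torsion_part G)).
suff /image_subgP : x \in S by [].
apply: torsion_part_generated tx => p p_prime y.
move/(proj1 (stable_onP _ _ _) (stable p p_prime)) => [z pz yE].
by apply/image_subgP; exists z; rewrite // (primary_torsion (prime_gt0 p_prime)).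
Qed.

Section TorsionSubgroup.
Variable G : zmodType.
Hypothesis coHopf : strongly_coHopfian G.

Lemma primary_uniformly_stable : strongly_coHopfian_on (@torsion G) ->
  exists N, forall (p : nat) (f : {additive G -> G}),
    prime p -> stable_on (primary G p) f N.
Proof.
move=> torsion_coHopf; have [pi [pi_primary pi_id]] := exists_primary_projections coHopf.
have /choice[F FP] (p : nat) : exists F : {additive G -> G}, prime p ->
    forall n, stable_on (primary G p) F n ->
    forall f : {additive G -> G}, stable_on (primary G p) f n.
  have [p_prime|] := boolP (prime p); last by exists idfun.
  have [F FP] := exists_extremal_endomorphism (primary_stable coHopf p_prime).
  by exists F.
have [f f_endo fE] := exists_torsion_glue pi_primary pi_id F.
have [f_torsion _] := f_endo; have [N] := torsion_coHopf f f_endo.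
rewrite same_img_iterP // => stable.
exists N => p g p_prime; apply: (FP p p_prime); apply/stable_onP => x px.
have iterE k y : torsion y -> pi p (iter k f y) = iter k (F p) (pi p y).
  move=> ty; elim: k => // k IH; rewrite !iterS fE ?IH //.
  by elim: (k) => // m; apply: f_torsion.
have tx : torsion x by apply/torsion_partP/(primary_torsion (prime_gt0 p_prime)).
have [y ty xyE] := stable x tx; exists (pi p y) => //.
by rewrite -iterE // -xyE iterE // pi_id.
Qed.

Lemma torsion_coHopfian_of_uniform :
  uniformly_strongly_coHopfian G -> strongly_coHopfian_on (@torsion G).
Proof.
move=> /uniformly_strongly_coHopfianP[N stable] f f_endo; exists N.
have [f_torsion fD] := f_endo; apply/same_img_iterP => // x [n n_gt0 xn0].
have [pi [pi_primary pi_id]] := exists_primary_projection coHopf n.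
have torsion_pi y : torsion (pi y).
  exact/torsion_partP/(primary_torsion n_gt0).
have [|g gE] := @additive_of_zmod_morphism G G (f \o pi).
  by move=> y z /=; apply/eqP; rewrite raddfB eq_sym subr_eq -fD ?subrK //= -raddfB.
have {}gE y : g y = f (pi y) by rewrite gE.
have f_invariant : invariant_under (primary G n) f.
  by move=> y py; rewrite -[y]pi_id // -gE primary_invariant.
have iter_gE k : {in primary G n, iter k g =1 iter k f}.
  move=> y py; elim: k => // k IH; rewrite !iterS IH gE pi_id //.
  exact: iter_invariant f_invariant _ py.
have px : x \in primary G n by apply/primaryP; exists 1%N.
have [y _ xyE] := proj1 (stable_onP _ _ _) (stable g) x isT.
by exists (pi y); rewrite // -iter_gE // xyE !iterSr gE iter_gE // f_invariant.
Qed.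

Lemma uniform_of_torsion_coHopfian :
  strongly_coHopfian_on (@torsion G) -> uniformly_strongly_coHopfian G.
Proof.
move=> /primary_uniformly_stable[N stable].
have [l rank_l] := divisible_part_finite_rank coHopf.
apply/uniformly_strongly_coHopfianP; exists (N + size l + N)%N => f.
have stable_f p p_prime := stable p f p_prime.
apply: (stable_mod_trans (Y := torsion_part G)) => //.
- exact: trivial_invariant.
- apply: (stable_mod_trans (Y := divisible_part G)) => //.
  + exact: torsion_part_invariant.
  + exact: full_mod_divisible_part_stable.
  + apply: finite_rank_stable_mod_torsion => //; last exact: divisible_part_invariant.
    exact: divisible_part_divisible.
- exact: torsion_stable.
Qed.

End TorsionSubgroup.

Theorem mainTheorem12 (G : zmodType) :
  strongly_coHopfian G ->
  (uniformly_strongly_coHopfian G <-> strongly_coHopfian_on (@torsion G)).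
Proof.
move=> coHopf; split; first exact: torsion_coHopfian_of_uniform.
exact: uniform_of_torsion_coHopfian.
Qed.
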